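(* If a family $\mathcal{O}$ of $n$ (not necessarily distinct) odd cycles in the complete graph $K_{n+1}$ has no rainbow odd cycle, then $\mathcal{O}$ is a pruned cactus.
   Context: A cycle is regarded as its set of edges; $\bigcup\mathcal{O}$ denotes the graph formed by the union of the edge sets of the members of $\mathcal{O}$. A family means a multiset (repetitions allowed). Given a family $\mathcal{E}$ of edge sets, an $\mathcal{E}$-rainbow set is a set $R\subseteq\bigcup\mathcal{E}$ together with an injection $\sigma:R\to\mathcal{E}$ with $e\in\sigma(e)$ for all $e\in R$. A rainbow odd cycle is a rainbow set forming a cycle of odd length. Pruned cactus (recursive definition): a family $\mathcal{O}$ of cycles is a pruned cactus if either all cycles in $\mathcal{O}$ are identical to one cycle on $|\mathcal{O}|+1$ vertices, or $\mathcal{O}$ can be partitioned into two pruned cacti $\mathcal{O}_1,\mathcal{O}_2$ such that the graphs $\bigcup\mathcal{O}_1$ and $\bigcup\mathcal{O}_2$ share exactly one vertex. *)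

(* Defs.v *)
From mathcomp Require Import all_boot.

Set Implicit Arguments.
Unset Strict Implicit.
Unset Printing Implicit Defensive.

(* Edges of the complete graph on V are two-element sets of vertices.  A
   multiset of edge sets is represented by a sequence, considered up to
   [perm_eq]; repeated members are distinguished by their positions. *)

Definition is_cycle (V : finType) (C : {set {set V}}) : Prop :=
  exists p : seq V,
    [/\ uniq p, 2 < size p & C = [set [set x; next p x] | x in p]].

Definition is_odd_cycle (V : finType) (C : {set {set V}}) : Prop :=
  is_cycle C /\ odd #|C|.

Definition union_graph (V : finType) (O : seq {set {set V}}) : {set {set V}} :=
  \bigcup_(C <- O) C.

(* The injection into the family is an injection into its positions, so that
   equal members may be used as often as they are repeated. *)
Definition rainbow (V : finType) (O : seq {set {set V}}) (R : {set {set V}})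
    : Prop :=
  R \subset union_graph O /\
  exists sigma : {set V} -> nat,
    {in R &, injective sigma} /\
    (forall e, e \in R -> sigma e < size O /\ e \in nth set0 O (sigma e)).

Definition has_rainbow_odd_cycle (V : finType) (O : seq {set {set V}}) : Prop :=
  exists R : {set {set V}}, is_odd_cycle R /\ rainbow O R.

(* [cover E] is the vertex set of the graph with edge set E. *)
Inductive pruned_cactus (V : finType) : seq {set {set V}} -> Prop :=
| pruned_cactus_cycle (O : seq {set {set V}}) (C : {set {set V}}) :
    is_cycle C -> #|cover C| = (size O).+1 ->
    (forall D, D \in O -> D = C) ->
    pruned_cactus O
| pruned_cactus_join (O O1 O2 : seq {set {set V}}) :
    perm_eq O (O1 ++ O2) ->
    pruned_cactus O1 -> pruned_cactus O2 ->
    #|cover (union_graph O1) :&: cover (union_graph O2)| = 1 ->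
    pruned_cactus O.

(* Main.v *)
(* Over F_2, a 2-colouring g of the vertices assigns to every edge the sum of
   the two colours of its ends, so that g is proper on an edge exactly when this
   value is 1; an odd cycle always has an edge of value 0.  Picking one edge t_i
   from every cycle O_i with as few proper 2-colourings as possible yields a
   rainbow spanning tree, in the guise of a common proper 2-colouring chi and of
   2-colourings h_i separating the ends of t_i and of no other t_j.  Every edge e
   then has coordinates (h_k e)_k, its tree path, and a sign: e is negative if
   chi is not proper on it, i.e. if e closes an odd cycle with its tree path.

   Call i ~ j if every negative edge of O_i has j on its tree path and vice
   versa.  Contracting all but two or three tree edges leaves a problem about
   sets of signed vectors in F_2^2 or F_2^3, settled by a finite search; the only
   use of graphs there is that the cuts h_i, h_j, h_k are pairwise laminar, which
   rules out the Fano configuration.  It shows that ~ is transitive and that, as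
   soon as the class b of i has another member, every edge of O_i is either one
   of the t_l with l in b or the edge closing the path formed by all of them, so
   that the cycles in a class coincide.  A parity argument along O_i excludes
   singleton classes.  Finally the classes are glued one at a time: connectedness
   of the tree makes the next class touch the current union, and counting tree
   edges shows that they share only one vertex. *)

Require Import Defs.
From mathcomp Require Import all_boot zify.

Set Implicit Arguments.
Unset Strict Implicit.
Unset Printing Implicit Defensive.

(** * Cuts and cycles *)

Section Cuts.
Variable V : finType.
Implicit Types (g : V -> bool) (e : {set V}) (C R : {set {set V}}) (p : seq V).

Definition cut g e : bool := \big[addb/false]_(x in e) g x.

Lemma cut2 g x y : x != y -> cut g [set x; y] = g x (+) g y.
Proof. by move=> nxy; rewrite /cut big_setU1 ?big_set1 // inE. Qed.

Lemma cutD g1 g2 e : cut (fun x => g1 x (+) g2 x) e = cut g1 e (+) cut g2 e.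
Proof. exact: big_split. Qed.

Lemma eq_cut g1 g2 e : g1 =1 g2 -> cut g1 e = cut g2 e.
Proof. by move=> eg; apply: eq_bigr. Qed.

Lemma cutM b g e : cut (fun x => b && g x) e = b && cut g e.
Proof. by case: b => //=; rewrite /cut big1. Qed.

Lemma cut_const b e : #|e| = 2 -> cut (fun=> b) e = false.
Proof. by move=> e2; rewrite /cut big_const e2 /= addbF addbb. Qed.

Lemma cut_sum (I : finType) (A : pred I) (h : I -> V -> bool) e :
  cut (fun x => \big[addb/false]_(i | A i) h i x) e =
  \big[addb/false]_(i | A i) cut (h i) e.
Proof. exact: exchange_big. Qed.

Lemma cut_pred1 x e : cut (pred1 x) e = (x \in e).
Proof.
rewrite /cut; case: (boolP (x \in e)) => xe; last first.
  rewrite big1 // => y ye; apply/negbTE; apply: contraNneq xe => <-; exact: ye.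
by rewrite (bigD1 x) //= eqxx big1 // => y /andP[_ /negPf].
Qed.

Lemma cut_eqF g e x y : #|e| = 2 -> ~~ cut g e -> x \in e -> y \in e -> g x = g y.
Proof.
move=> /eqP/cards2P[a [b [nab ->]]]; rewrite cut2 // !inE => gab.
by case/orP=> /eqP-> /orP[]/eqP->; move: gab; case: (g a); case: (g b).
Qed.

Lemma cut_const_on g e : #|e| = 2 -> {in e &, forall x y, g x = g y} -> ~~ cut g e.
Proof.
move=> /eqP/cards2P[a [b [nab ->]]] ge; rewrite cut2 // (ge a b) ?addbb //;
  by rewrite !inE eqxx ?orbT.
Qed.

Lemma eq_cut_in g g' e : {in e, g =1 g'} -> cut g e = cut g' e.
Proof. by move=> gg; apply: eq_bigr. Qed.
Lemma next_neq p x : uniq p -> 1 < size p -> x \in p -> next p x != x.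
Proof.
move=> Up szp xp; have [i q Eq] := rot_to xp.
have Uq : uniq (x :: q) by rewrite -Eq rot_uniq.
rewrite -(next_rot i Up) Eq; case: q Uq Eq => [|y q] Uq Eq.
  by move: szp; rewrite -(size_rot i) Eq.
by rewrite /= eqxx; move: Uq; rewrite /= inE negb_or eq_sym => /andP[/andP[]].
Qed.

Lemma next_next_neq p x : uniq p -> 2 < size p -> x \in p ->
  next p (next p x) != x.
Proof.
move=> Up szp xp; have [i q Eq] := rot_to xp.
have Uq : uniq (x :: q) by rewrite -Eq rot_uniq.
rewrite -!(next_rot i Up) Eq; case: q Uq Eq => [|y [|z q]] Uq Eq;
  try by move: szp; rewrite -(size_rot i) Eq.
move: Uq; rewrite /= !inE !negb_or => /andP[/and3P[nxy nxz _] _].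
by rewrite eqxx [y == x]eq_sym (negPf nxy) eqxx eq_sym.
Qed.

Lemma cycle_edge_inj p : uniq p -> 2 < size p ->
  {in p &, injective (fun x => [set x; next p x])}.
Proof.
move=> Up szp x y xp yp exy.
have: x \in [set y; next p y] by rewrite -exy !inE eqxx.
have: y \in [set x; next p x] by rewrite exy !inE eqxx.
rewrite !inE => /orP[/eqP->//|/eqP Ey] /orP[/eqP//|/eqP Ex].
by move: (next_next_neq Up szp xp); rewrite -Ey -Ex eqxx.
Qed.

Lemma cycle_cut_sum p g : uniq p ->
  \big[addb/false]_(x in p) (g x (+) g (next p x)) = false.
Proof.
move=> Up; rewrite big_split /=.
rewrite (reindex_inj (can_inj (prev_next Up))) /=.
rewrite (eq_bigl (fun x => x \in p)) ?addbb // => x.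
by rewrite /= mem_next.
Qed.

Lemma next_closed p (P : pred V) x : uniq p -> x \in p -> P x ->
  {in p, forall y, P y -> P (next p y)} -> {in p, forall y, P y}.
Proof.
move=> Up xp Px clP y yp.
have /iter_findex <- : fconnect (next p) x y
  by rewrite (fconnect_cycle (cycle_next Up) xp).
elim: (findex _ _ _) => //= k IH; apply: (clP) => //.
by elim: k {IH} => //= k IH; rewrite mem_next.
Qed.

Lemma cycle_edge_card C e : is_cycle C -> e \in C -> #|e| = 2.
Proof.
case=> p [Up szp ->] /imsetP[x xp ->].
by rewrite cards2 eq_sym next_neq // ltnW.
Qed.

Lemma card_cycle p : uniq p -> 2 < size p ->
  #|[set [set x; next p x] | x in p]| = size p.
Proof.
by move=> Up szp; rewrite card_in_imset ?(card_uniqP Up) //; apply: cycle_edge_inj.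
Qed.

Lemma card_cover_cycle C : is_cycle C -> #|cover C| = #|C|.
Proof.
case=> p [Up szp EC]; rewrite EC card_cycle // -(card_uniqP Up).
apply: eq_card => x; apply/bigcupP/idP => [[e /imsetP[y yp ->]]|xp].
  by rewrite !inE => /orP[/eqP->|/eqP->] //; rewrite mem_next.
by exists [set x; next p x]; [apply: imset_f | rewrite !inE eqxx].
Qed.

Lemma odd_cycle_cut C g : is_odd_cycle C -> exists2 e, e \in C & ~~ cut g e.
Proof.
case=> -[p [Up szp EC]]; rewrite EC card_cycle // => odd_p.
suff [x xp gx] : exists2 x, x \in p & ~~ (g x (+) g (next p x)).
  exists [set x; next p x]; first exact: imset_f.
  by rewrite cut2 // eq_sym next_neq // ltnW.
apply/exists_inP; apply: contraLR odd_p; rewrite negb_exists_in => /forall_inP gp.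
have := cycle_cut_sum g Up; rewrite (eq_bigr (fun=> true)); last first.
  by move=> x xp; have := gp x xp; rewrite negbK.
rewrite big_const (card_uniqP Up) => Ep.
suff -> : odd (size p) = iter (size p) (addb true) false by rewrite Ep.
by elim: (size p) => //= k ->.
Qed.

(** Induction on the number of edges. If the colouring [g] of [R :\ e] fails on [e], a path in
    [R :\ e] between the ends of [e] has even length and closes to an odd cycle; without such a
    path, the component of one end is flipped. *)
Lemma no_odd_cycle_bipartite R : (forall e, e \in R -> #|e| = 2) ->
  (forall C, C \subset R -> ~ is_odd_cycle C) ->
  exists g, forall e, e \in R -> cut g e.
Proof.
have [k] := ubnP #|R|; elim: k R => // k IH R; rewrite ltnS => leRk R2 noC.
have [->|[e eR]] := set_0Vmem R.
  by exists (fun=> false) => e; rewrite inE.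
have [|e1 /setD1P[_]||g gP] := IH (R :\ e).
- by rewrite (leq_trans _ leRk) // [X in _ < X](cardsD1 e) eR.
- exact: R2.
- by move=> C sCR; apply: noC; apply: subset_trans sCR (subsetDl _ _).
have /cards2P[a [b [nab Ee]]] : #|e| == 2 by rewrite R2.
case: (boolP (cut g e)) => [ge|].
  exists g => e1 e1R; have [->//|ne1] := eqVneq e1 e.
  by apply: gP; rewrite !inE ne1.
rewrite {1}Ee cut2 // => gab.
pose r := [rel x y : V | [set x; y] \in R :\ e].
have r_sym : connect_sym r.
  by apply: sym_connect_sym => x y; rewrite /= setUC.
have r_neq x y : r x y -> x != y.
  by case/setD1P=> _ /R2; rewrite cards2; case: (x == y).
have r_alt x y : r x y -> g y = ~~ g x.
  move=> rxy; move: (gP _ rxy); rewrite cut2 ?r_neq //.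
  by case: (g x); case: (g y).
case: (boolP (connect r a b)) => [/connectP[p0 /shortenP[p rp Up _] Eb]|nab_r].
  have g_last x q : path r x q -> g (last x q) = g x (+) odd (size q).
    elim: q x => [|y q IHq] x /=; first by rewrite addbF.
    by case/andP=> /r_alt gy /IHq ->; rewrite gy addNb addbN.
  have odd_p : ~~ odd (size p).
    move: (g_last _ _ rp) gab; rewrite -Eb => ->.
    by case: (g a); case: odd.
  have szp : 2 < size (a :: p).
    case: p rp Eb odd_p {Up} => [|c [|d p]] //= _ Eb.
    by rewrite Eb eqxx in nab.
  case: (noC [set [set x; next (a :: p) x] | x in a :: p]).
    apply/subsetP=> _ /imsetP[x xp ->].
    pose r' := [rel x y : V | [set x; y] \in R].
    suff cyc : cycle r' (a :: p) by exact: (next_cycle cyc xp).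
    rewrite /= rcons_path -Eb /r' /= setUC -Ee eR andbT.
    by apply: sub_path rp => x' y' /setD1P[].
  split; first by exists (a :: p).
  by rewrite card_cycle //= odd_p.
exists (fun x => g x (+) connect r a x) => e1 e1R.
have [->|ne1] := eqVneq e1 e.
  by rewrite Ee cut2 // connect0 (negPf nab_r) addbT addbF; case: (g a) (g b) gab => -[].
have e1R' : e1 \in R :\ e by rewrite !inE ne1.
rewrite cutD gP //; suff -> : cut (connect r a) e1 = false by [].
have /cards2P[x [y [nxy E1]]] : #|e1| == 2 by rewrite R2.
have rxy : connect r x y by apply: connect1; rewrite /= -E1.
by rewrite E1 cut2 // (same_connect_r r_sym rxy) addbb.
Qed.
End Cuts.

(** * Rainbow sets of signed vectors in three coordinates *)

(* Three tree coordinates of an edge followed by its sign, [true] for negative. *)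
Definition vec := (bool * bool * bool * bool)%type.

Definition vadd (u v : vec) : vec :=
  let: (x, y, z, s) := u in let: (x', y', z', s') := v in
  (x (+) x', y (+) y', z (+) z', s (+) s').

Definition vzero : vec := (false, false, false, false).

Definition omega : vec := (false, false, false, true).

(** The linear form with coefficients [f], extended by the value 1 on [omega]. *)
Definition veval (f : bool * bool * bool) (v : vec) : bool :=
  let: (x, y, z, s) := v in let: (a, b, c) := f in
  (a && x) (+) (b && y) (+) (c && z) (+) s.

Lemma vevalD f u v : veval f (vadd u v) = veval f u (+) veval f v.
Proof.
case: f u v => [[a b] c] [[[x y] z] s] [[[x' y'] z'] s'] /=.
by rewrite !andb_addr (AC (2*2*2*2) ((1*3*5*7)*(2*4*6*8))).
Qed.

(* [M c] is the set of vectors of colour [c < 3] and [A c] a superset of it.  For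
   the colours in [act], the second clause says that [M c] spans [omega]; the
   third one says that no rainbow choice does ([vzero] stands for no choice). *)
Definition rainbow_model (act : seq nat) (A : nat -> pred vec)
    (M : nat -> vec -> Prop) : Prop :=
  [/\ forall c v, M c v -> A c v,
      forall c f, c \in act -> exists2 v, M c v & veval f v
    & forall v : nat -> vec, (forall c, M c (v c) \/ v c = vzero) ->
      exists f, forall c, c < 3 -> ~~ veval f (v c)].

Definition facts (s : seq (nat * vec)) (c : nat) : seq vec :=
  vzero :: [seq cv.2 | cv <- s & cv.1 == c].

Definition conflict (s : seq (nat * vec)) : bool :=
  has (fun u => has (fun v => vadd omega (vadd u v) \in facts s 2) (facts s 1))
      (facts s 0).

Arguments conflict : simpl never.

Definition bits := [:: false; true].

Definition functionals : seq (bool * bool * bool) :=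
  [seq (ab, c) | ab <- [seq (a, b) | a <- bits, b <- bits], c <- bits].

Definition vecs : seq vec := [seq (f, s) | f <- functionals, s <- bits].

Definition unmet (act : seq nat) (s : seq (nat * vec)) :=
  [seq cf <- [seq (c, f) | c <- act, f <- functionals]
     | ~~ has (veval cf.2) (facts s cf.1)].

(* A functional [f] that is still 0 on all known vectors of colour [c] must be 1
   on some vector of [M c]; every candidate is tried, to depth [k].
   Nested conditionals rather than [||], [==>]: these evaluate both arguments
   under [vm_compute]. *)
Fixpoint refute (k : nat) (act : seq nat) (A : nat -> pred vec)
    (s : seq (nat * vec)) : bool :=
  if has (fun cv => ~~ A cv.1 cv.2) s then true else
  if conflict s then true else
  if k isn't k'.+1 then false else
  if unmet act s is (c, f) :: _ then
    if c \in act then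
      all (fun v => if veval f v then refute k' act A ((c, v) :: s) else true)
          vecs
    else false
  else false.

Lemma mem_vecs v : v \in vecs.
Proof. by case: v => [[[[] []] []] []]. Qed.

(** A choice summing to [omega] cannot be annihilated by a functional, since each takes the value 1
    on [omega]. *)
Lemma conflictP act A M s : rainbow_model act A M ->
  (forall cv, cv \in s -> M cv.1 cv.2) -> ~~ conflict s.
Proof.
case=> _ _ nr sM; apply/hasPn => u u0; apply/hasPn => v v1; apply/negP => w2.
have factP c x : x \in facts s c -> M c x \/ x = vzero.
  rewrite inE => /predU1P[->|/mapP[[c' y]]]; first by right.
  by rewrite mem_filter /= => /andP[/eqP -> /sM ?] ->; left.
pose sel c :=
  match c with 0 => u | 1 => v | 2 => vadd omega (vadd u v) | _ => vzero end.
have [[|[|[|c]]]|f fP] := nr sel; [exact: factP..|by right|].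
have : ~~ veval f (vadd omega (vadd u v)) := fP 2 isT; rewrite !vevalD.
rewrite (negPf (fP 0 isT : ~~ veval f u)) (negPf (fP 1 isT : ~~ veval f v)).
by case: f {fP} => [[[] []] []].
Qed.

Lemma refuteP k act A M s : rainbow_model act A M ->
  (forall cv, cv \in s -> M cv.1 cv.2) -> ~~ refute k act A s.
Proof.
move=> mM; elim: k s => [|k IH] s sM; rewrite /refute -/refute.
  case: ifP => [/hasP[cv /sM]|_]; first by case: mM => AM _ _ /AM ->.
  by rewrite (negPf (conflictP mM sM)).
case: ifP => [/hasP[cv /sM]|_]; first by case: mM => AM _ _ /AM ->.
rewrite (negPf (conflictP mM sM)).
case: (unmet act s) => // -[c f] _; case: ifP => // c_act.
case: (mM) => _ /(_ c f c_act)[v Mv fv] _.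
apply/allPn; exists v; first exact: mem_vecs.
rewrite fv; apply: IH => cv.
by rewrite inE => /predU1P[->//|]; apply: sM.
Qed.

(* The coordinate patterns of which one does not occur: [(true, true, true)] if
   the three tree edges form a star after contracting the others, and a pattern
   with two entries if they form a path. *)
Definition missable :=
  [:: (true, true, false); (true, false, true); (false, true, true);
      (true, true, true)].

Definition free_octants (p1 p2 p3 : bool * bool) :=
  [seq v <- functionals
     | [&& (v.1.1, v.1.2) != p1, (v.1.2, v.2) != p2 & (v.1.1, v.2) != p3]].

(** [p1], [p2], [p3] stand for quadrants left empty by the three pairs of cuts; an edge is the
    difference of two vertices in the remaining octants. *)
Lemma quadrants_miss p1 p2 p3 :
  has (fun m => all (fun u => all (fun v =>
      (u.1.1 (+) v.1.1, u.1.2 (+) v.1.2, u.2 (+) v.2) != m)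
    (free_octants p1 p2 p3)) (free_octants p1 p2 p3)) missable.
Proof. by case: p1 => [[] []]; case: p2 => [[] []]; case: p3 => [[] []]. Qed.

Definition vx (v : vec) : bool := v.1.1.1.
Definition vy (v : vec) : bool := v.1.1.2.
Definition vz (v : vec) : bool := v.1.2.
Definition negative_imp (q : pred vec) : pred vec := fun v => v.2 ==> q v.

(** The two vectors put in front of [s] are the tree edges of the two colours; the number 20 is only
    fuel. *)
Definition refute2 (A0 A1 : pred vec) (s : seq (nat * vec)) : bool :=
  refute 20 [:: 0; 1] (fun c v => nth xpredT [:: A0; A1] c v && ~~ vz v)
    ((0, (true, false, false, false)) :: (1, (false, true, false, false)) :: s).

(** Which pattern [m] is missing depends on the tree, so the search has to succeed for each of
    them. *)
Definition refute3 (A0 A1 A2 : pred vec) (s : seq (nat * vec)) : bool :=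
  all (fun m => refute 20 [:: 0; 1; 2]
         (fun c v => nth xpredT [:: A0; A1; A2] c v && (v.1 != m))
         ((0, (true, false, false, false)) :: (1, (false, true, false, false)) ::
          (2, (false, false, true, false)) :: s))
      missable.

(** * The rainbow spanning tree *)

Section Family.
Variables (V : finType) (n : nat) (O : 'I_n -> {set {set V}}).
Hypothesis cardV : #|V| = n.+1.
Hypothesis Oodd : forall i, is_odd_cycle (O i).
Hypothesis Orainbow : forall s : 'I_n -> {set V}, (forall i, s i \in O i) ->
  exists g, forall i, cut g (s i).

Let O2 i e : e \in O i -> #|e| = 2.
Proof. by have [cyc _] := Oodd i; apply: cycle_edge_card. Qed.

Let Ocut i g : exists2 e, e \in O i & ~~ cut g e.
Proof. exact: odd_cycle_cut. Qed.

(* With a choice [s] having the fewest proper colourings, no [s i] is redundant: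
   otherwise replacing [s i] by an edge of [O i] on which some proper colouring
   of [s] fails would leave fewer. *)
Lemma rainbow_tree :
  exists (t : 'I_n -> {set V}) (chi : V -> bool) (h : 'I_n -> V -> bool),
  [/\ forall i, t i \in O i, forall i, cut chi (t i)
    & forall i j, cut (h i) (t j) = (i == j)].
Proof.
pose proper (s : {ffun 'I_n -> {set V}}) (g : {ffun V -> bool}) (i : 'I_n) :=
  cut g (s i).
pose N s := #|[set g | [forall i, proper s g i]]|.
have [s0 s0O] : exists s0 : {ffun 'I_n -> {set V}}, [forall i, s0 i \in O i].
  have [s sO] : exists s : 'I_n -> {set V}, forall i, s i \in O i.
    apply: (@fin_all_exists _ (fun=> {set V}) (fun i e => e \in O i)) => i.
    by have [e eO _] := Ocut i (fun=> false); exists e.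
  by exists [ffun i => s i]; apply/forallP => i; rewrite ffunE.
pose choice (s : {ffun 'I_n -> {set V}}) := [forall i, s i \in O i].
case: (@arg_minnP _ s0 choice N s0O) => s /forallP sO smin.
have [chi chiP] := Orainbow sO.
have [g gP] : exists g : 'I_n -> {ffun V -> bool},
    forall i, (forall j, j != i -> proper s (g i) j) /\ ~~ proper s (g i) i.
  apply: (@fin_all_exists _ (fun=> {ffun V -> bool})
    (fun i g => (forall j, j != i -> proper s g j) /\ ~~ proper s g i)) => i.
  suff /existsP[g /andP[/forall_inP gi ngi]] : [exists g : {ffun V -> bool},
      [forall (j | j != i), proper s g j] && ~~ proper s g i].
    by exists g.
  apply: contraT; rewrite negb_exists => /forallP redundant.
  have [e eO ce] := Ocut i chi.
  pose s' := [ffun j => if j == i then e else s j].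
  have s'O : [forall j, s' j \in O j].
    by apply/forallP => j; rewrite ffunE; case: eqP => [->|].
  suff: N s' < N s by rewrite ltnNge smin.
  apply: proper_card; apply/properP; split.
    apply/subsetP=> g; rewrite !inE => /forallP gs'.
    have gs j : j != i -> proper s g j.
      by move=> nji; move: (gs' j); rewrite /proper ffunE (negPf nji).
    apply/forallP=> j; have [->|/gs//] := eqVneq j i.
    move: (redundant g); rewrite negb_and negbK => /orP[/forall_inP|//].
    by case; apply: gs.
  exists [ffun x => chi x]; rewrite inE.
    by apply/forallP=> j; rewrite /proper (eq_cut _ (ffunE chi)).
  apply/forallPn; exists i.
  by rewrite /proper ffunE eqxx (eq_cut _ (ffunE chi)).
exists s, chi, (fun i x => g i x (+) chi x); split=> // i j.
rewrite cutD chiP -/(proper s (g i) j); case: (gP i) => gij gii.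
have [<-|nij] := eqVneq i j; first by rewrite (negPf gii).
by rewrite (gij j) // eq_sym.
Qed.

Section Tree.
Variables (t : 'I_n -> {set V}) (chi : V -> bool) (h : 'I_n -> V -> bool).
Hypothesis tO : forall i, t i \in O i.
Hypothesis tchi : forall i, cut chi (t i).
Hypothesis th : forall i j, cut (h i) (t j) = (i == j).

Let t2 i : #|t i| = 2. Proof. exact: O2 (tO i). Qed.

(** The sums of the [h l] over subsets of [L], with or without the constant 1, restrict to different
    functions on [X], because their cuts on the [t l] recover the subset. Hence [2 ^ (#|L| + 1)] is
    at most [2 ^ #|X|]. *)
Lemma tree_card (L : {set 'I_n}) (X : {set V}) : X != set0 ->
  (forall l, l \in L -> t l \subset X) -> #|L| < #|X|.
Proof.
case/set0Pn=> x0 x0X tX.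
pose G (Ac : {set 'I_n} * bool) x := Ac.2 (+) \big[addb/false]_(l in Ac.1) h l x.
pose F Ac := [set x in X | G Ac x].
have GF Ac x : x \in X -> G Ac x = (x \in F Ac) by rewrite inE => ->.
have cutG Ac l : cut (G Ac) (t l) = (l \in Ac.1).
  rewrite cutD cut_const // cut_sum addFb; case: (boolP (l \in _)) => lA.
    by rewrite (bigD1 l) //= th eqxx big1 // => j /andP[_ /negPf]; rewrite th.
  by rewrite big1 // => j jA; rewrite th; apply: contraNF lA => /eqP <-.
suff Finj : {in setX (powerset L) [set: bool] &, injective F}.
  have sF : F @: setX (powerset L) [set: bool] \subset powerset X.
    apply/subsetP=> _ /imsetP[Ac _ ->]; rewrite inE; apply/subsetP=> x.
    by rewrite inE => /andP[].
  have := subset_leq_card sF; rewrite card_in_imset // cardsX !card_powerset cardsT.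
  by rewrite card_bool -expnSr leq_exp2l.
case=> [A c] [A' c']; rewrite !inE !andbT /= => sA sA' eF.
have eG x : x \in X -> G (A, c) x = G (A', c') x by move=> xX; rewrite !GF // eF.
have eA : A = A'.
  apply/setP=> l; case: (boolP (l \in L)) => lL; last first.
    by rewrite (negPf (contra (subsetP sA l) lL)) (negPf (contra (subsetP sA' l) lL)).
  rewrite -(cutG (A, c) l) -(cutG (A', c') l); apply: eq_cut_in => x xl.
  by apply: eG; apply: subsetP (tX l lL) x xl.
by move: (eG x0 x0X); rewrite eA /G /= => /addIb ->.
Qed.

(** Were both colours present, each colour class would contain fewer tree edges than vertices,
    leaving at most [n - 1] tree edges in all. *)
Lemma tree_connected g : (forall i, ~~ cut g (t i)) -> forall x y, g x = g y.
Proof.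
move=> gt x y; apply/eqP; apply: contraT => gxy.
pose X := [set z | g z == g x]; pose L := [set i | t i \subset X].
have tX i : (t i \subset X) || (t i \subset ~: X).
  have /cards2P[a [b [nab Et]]] : #|t i| == 2 by rewrite t2.
  have gab : g a = g b.
    by apply: (cut_eqF (t2 i)); rewrite // Et !inE eqxx ?orbT.
  by rewrite Et !subUset !sub1set !inE gab; case: eqP.
have ltL : #|L| < #|X|.
  apply: tree_card => [|l]; last by rewrite inE.
  by apply/set0Pn; exists x; rewrite inE.
have ltLC : #|~: L| < #|~: X|.
  apply: tree_card => [|l]; first by apply/set0Pn; exists y; rewrite !inE eq_sym.
  by rewrite !inE; have := tX l; case: (_ \subset X).
have := leq_add ltL ltLC; rewrite addSn addnS cardsC cardsC cardV card_ord.
by rewrite ltnn.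
Qed.

(** The [h l] are dual to the [t l]: adding to [g] the [h l] with [cut g (t l)] gives a colouring
    constant along the tree, hence constant. *)
Lemma cut_expand g (e : {set V}) : #|e| = 2 ->
  cut g e = \big[addb/false]_l (cut g (t l) && cut (h l) e).
Proof.
move=> e2; pose g' x := g x (+) \big[addb/false]_(l | cut g (t l)) h l x.
have g'c : forall x y, g' x = g' y.
  apply: tree_connected => i; rewrite cutD cut_sum.
  case: (boolP (cut g (t i))) => gi.
    by rewrite (bigD1 i) //= th eqxx big1 // => j /andP[_ /negPf]; rewrite th.
  rewrite big1 // => j gj; rewrite th; apply: contraNF gi => /eqP <- //.
have : ~~ cut g' e by apply: cut_const_on => // x y _ _.
rewrite cutD cut_sum big_mkcond /= ; rewrite negb_add => /eqP ->.
by apply: eq_bigr => l _; case: (cut g _).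
Qed.

Lemma edge_eq (e e' : {set V}) : #|e| = 2 -> #|e'| = 2 ->
  (forall l, cut (h l) e = cut (h l) e') -> e = e'.
Proof.
move=> e2 e2' ee; apply/setP=> x; rewrite -!cut_pred1 !cut_expand //.
by apply: eq_bigr => l _; rewrite ee.
Qed.

Lemma vertex_eq x y : (forall l, h l x = h l y) -> x = y.
Proof.
move=> hxy; apply/eqP; apply: contraT => nxy.
have e2 : #|[set x; y]| = 2 by rewrite cards2 nxy.
have := cut_pred1 x [set x; y]; rewrite set21 cut_expand // big1 // => l _.
by rewrite cut2 // hxy addbb andbF.
Qed.

(* The two cuts of distinct tree edges leave one of the four quadrants empty,
   since the product of two coordinates is not affine on the whole of F_2^2. *)
Lemma cut_laminar i k : i != k ->
  exists cd : bool * bool, forall x, (h i x, h k x) != cd.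
Proof.
move=> nik; case: (boolP [exists cd, forall x, (h i x, h k x) != cd]).
  by case/existsP=> cd /forallP; exists cd.
rewrite negb_exists => /forallP full.
have {}full c d : exists2 x, h i x = c & h k x = d.
  have /forallPn[x] := full (c, d); rewrite negbK => /eqP[<- <-].
  by exists x.
pose g x := h i x && h k x.
pose g' x := g x (+) (cut g (t i) && h i x) (+) (cut g (t k) && h k x).
have g'c : forall x y, g' x = g' y.
  apply: tree_connected => l; rewrite !cutD !cutM !th.
  have [<-|nil] := eqVneq i l.
    by rewrite [k == i]eq_sym (negPf nik) andbF andbT addbF addbb.
  have [<-|nkl] := eqVneq k l; first by rewrite andbF andbT addbF addbb.
  rewrite !andbF !addbF; apply: cut_const_on => // x y xl yl.
  by rewrite /g !(cut_eqF (t2 l) _ xl yl) ?th ?(negPf nil) ?(negPf nkl).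
have [x00 h1 h2] := full false false; have [x01 h3 h4] := full false true.
have [x10 h5 h6] := full true false; have [x11 h7 h8] := full true true.
move: (g'c x00 x01) (g'c x00 x10) (g'c x00 x11).
by rewrite /g' /g h1 h2 h3 h4 h5 h6 h7 h8; case: (cut _ (t i)); case: (cut _ (t k)).
Qed.

Lemma pattern_missing i j k : i != j -> j != k -> i != k ->
  exists2 m, m \in missable & forall e : {set V}, #|e| = 2 ->
    (cut (h i) e, cut (h j) e, cut (h k) e) != m.
Proof.
move=> nij njk nik.
have [p1 P1] := cut_laminar nij; have [p2 P2] := cut_laminar njk.
have [p3 P3] := cut_laminar nik.
have /hasP[m mm mP] := quadrants_miss p1 p2 p3.
exists m => // e /eqP/cards2P[x [y [nxy ->]]]; rewrite !cut2 //.
pose v z := (h i z, h j z, h k z).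
have vP z : v z \in free_octants p1 p2 p3.
  by rewrite mem_filter P1 P2 P3 /= /v; case: (h i z); case: (h j z); case: (h k z).
exact: (allP (allP mP (v x) (vP x)) (v y) (vP y)).
Qed.

(** * Projection of edges to two or three tree coordinates *)

Definition coord (k : option 'I_n) : V -> bool := oapp h (fun=> false) k.

(** With [k = None] the third coordinate is 0, so that two colours fit the same format as three. *)
Definition pat (i j : 'I_n) (k : option 'I_n) (e : {set V}) : vec :=
  (cut (h i) e, cut (h j) e, cut (coord k) e, ~~ cut chi e).

Definition colour (i j : 'I_n) (k : option 'I_n) (c : nat) : option 'I_n :=
  match c with 0 => Some i | 1 => Some j | 2 => k | _ => None end.

Definition pat_model i j k (c : nat) (v : vec) : Prop :=
  exists2 l, colour i j k c = Some l & exists2 e, e \in O l & pat i j k e = v.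

(** All other colours, and those where [v] is [vzero], contribute their tree edges. A proper
    colouring of this choice differs from [chi], up to a constant, by a combination of the cuts
    considered; its coefficients are the functional. *)
Lemma pat_rainbow_model act (A : nat -> pred vec) i j k :
  i != j -> Some i != k -> Some j != k ->
  (forall c, c \in act -> colour i j k c != None) ->
  (forall c l e, colour i j k c = Some l -> e \in O l -> A c (pat i j k e)) ->
  rainbow_model act A (pat_model i j k).
Proof.
move=> nij nik njk actP AP; split.
- by move=> c v [l cl [e eO <-]]; apply: AP cl eO.
- move=> c [[a b] d] /actP; case cl: (colour i j k c) => [l|] // _.
  pose g x := (a && h i x) (+) (b && h j x) (+) (d && coord k x) (+) chi x.
  have [e eO ge] := Ocut l g.
  exists (pat i j k e); first by exists l => //; exists e.
  by move: ge; rewrite /g !cutD !cutM /= addbN.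
move=> v vP.
have pick c l : colour i j k c = Some l -> exists2 e, e \in O l &
    v c = pat i j k e \/ v c = (false, false, false, false).
  move=> cl; case: (vP c) => [[l' cl' [e eO <-]]|->]; last by exists (t l); auto.
  by move: cl'; rewrite cl => -[->]; exists e; auto.
have [e0 e0O v0] := pick 0 i erefl; have [e1 e1O v1] := pick 1 j erefl.
have [e2 e2O v2] : exists2 e2, (forall l, k = Some l -> e2 \in O l) &
    v 2 = (false, false, false, false) \/ k <> None /\ v 2 = pat i j k e2.
  case: k pick vP {nik njk actP AP e0O e1O v0 v1} => [l|] pick vP.
    have [e eO ve] := pick 2 l erefl; exists e => [l' [<-]//|].
    by case: ve => [?|?]; [right | left].
  by exists (t i) => //; case: (vP 2) => [[]|]; auto.
pose s l := if l == i then e0 else if l == j then e1 else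
            if Some l == k then e2 else t l.
have [|g gs] := Orainbow (s := s).
  move=> l; rewrite /s; case: eqP => [->//|_]; case: eqP => [->//|_].
  by case: eqP => // /esym/e2O.
pose f l := cut (fun x => g x (+) chi x) (t l).
have fE e l : e \in O l -> cut g e ->
    ~~ veval (f i, f j, oapp f false k) (pat i j k e).
  move=> eO ge; have := cut_expand (fun x => g x (+) chi x) (O2 eO).
  rewrite cutD ge addTb /= => ->.
  have fF l' : s l' = t l' -> f l' = false.
    by move=> sl; rewrite /f cutD tchi -sl gs.
  rewrite (bigD1 i) // (bigD1 j) 1?eq_sym //= -/(f i) -/(f j).
  have -> : \big[addb/false]_(l' | (l' != i) && (l' != j)) (f l' && cut (h l') e)
    = oapp f false k && cut (coord k) e.
    case Ek: k => [k'|] /=; last first.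
      apply: big1 => l' /andP[li lj].
      by rewrite fF // /s (negPf li) (negPf lj) Ek.
    rewrite Ek in nik njk.
    rewrite (bigD1 k') /=; last by rewrite ![k' == _]eq_sym nik.
    rewrite big1 ?addbF // => l' /andP[/andP[li lj] lk].
    by rewrite fF // /s (negPf li) (negPf lj) Ek (negPf (lk : Some l' != Some k')).
  by case: (f i && _); case: (f j && _); case: (_ && _).
exists (f i, f j, oapp f false k).
have z0 : ~~ veval (f i, f j, oapp f false k) (false, false, false, false).
  by rewrite /= !andbF.
case=> [|[|[|c]]] // _.
- case: v0 => -> //; apply: fE e0O _.
  by move: (gs i); rewrite /s eqxx.
- case: v1 => -> //; apply: fE e1O _.
  by move: (gs j); rewrite /s eq_sym (negPf nij) eqxx.
case: v2 => [->//|[kN ->]]; case Ek: k kN => [k'|//] _.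
rewrite -Ek; apply: fE (e2O _ Ek) _; move: (gs k').
rewrite /s -Ek eqxx; rewrite Ek in nik njk.
by rewrite ![k' == _]eq_sym (negPf (nik : i != k')) (negPf (njk : j != k')).
Qed.

(** * Classes of colours *)

Lemma pat_model_tree i j k c l : colour i j k c = Some l ->
  pat_model i j k c (i == l, j == l, k == Some l, false).
Proof.
move=> cl; exists l => //; exists (t l) => //; rewrite /pat !th tchi /coord.
congr (_, _, _); case: k {cl} => [k|] /=; first by rewrite th.
by rewrite /cut big1.
Qed.

Lemma refute2P i j (A0 A1 : pred vec) s : i != j ->
  {in O i, forall e, A0 (pat i j None e)} ->
  {in O j, forall e, A1 (pat i j None e)} ->
  foldr (fun cv Q => pat_model i j None cv.1 cv.2 /\ Q) True s ->
  ~~ refute2 A0 A1 s.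
Proof.
move=> nij A0P A1P sP; apply: (@refuteP _ _ _ (pat_model i j None)).
  apply: pat_rainbow_model => // [c|c l e].
    by rewrite !inE => /orP[]/eqP->.
  have zF : ~~ vz (pat i j None e) by rewrite /vz /= /cut big1.
  by rewrite zF andbT; case: c => [|[|[|c]]] //= [<-]; [apply: A0P | apply: A1P].
move=> cv; rewrite !inE => /or3P[/eqP->|/eqP->|] /=.
- by have := @pat_model_tree i j None 0 i erefl; rewrite eqxx eq_sym (negPf nij).
- by have := @pat_model_tree i j None 1 j erefl; rewrite eqxx (negPf nij).
by elim: s sP => //= cv' s IH [Mcv' /IH{}IH]; rewrite inE => /predU1P[->|].
Qed.

Lemma refute3P i j k (A0 A1 A2 : pred vec) s : i != j -> j != k -> i != k ->
  {in O i, forall e, A0 (pat i j (Some k) e)} ->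
  {in O j, forall e, A1 (pat i j (Some k) e)} ->
  {in O k, forall e, A2 (pat i j (Some k) e)} ->
  foldr (fun cv Q => pat_model i j (Some k) cv.1 cv.2 /\ Q) True s ->
  ~~ refute3 A0 A1 A2 s.
Proof.
move=> nij njk nik A0P A1P A2P sP; have [m mm mP] := pattern_missing nij njk nik.
apply/allPn; exists m => //; apply: (@refuteP _ _ _ (pat_model i j (Some k))).
  apply: pat_rainbow_model => // [c|c l e].
    by rewrite !inE => /or3P[]/eqP->.
  move=> cl eO; rewrite (mP e (O2 eO)) andbT.
  by case: c cl => [|[|[|c]]] //= [El]; rewrite -El in eO;
    [apply: A0P | apply: A1P | apply: A2P].
move=> cv; rewrite !inE => /or4P[/eqP->|/eqP->|/eqP->|] /=.
- have := @pat_model_tree i j (Some k) 0 i erefl.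
  rewrite eqxx [j == i]eq_sym (negPf nij) [_ == Some i]eq_sym.
  by rewrite (negPf (nik : Some i != Some k)).
- have := @pat_model_tree i j (Some k) 1 j erefl.
  by rewrite eqxx (negPf nij) [_ == Some j]eq_sym (negPf (njk : Some j != Some k)).
- have := @pat_model_tree i j (Some k) 2 k erefl.
  by rewrite !eqxx (negPf nik) (negPf njk).
by elim: s sP => //= cv' s IH [Mcv' /IH{}IH]; rewrite inE => /predU1P[->|].
Qed.

Definition arrow i j := [forall e in O i, ~~ cut chi e ==> cut (h j) e].
Definition sim i j := arrow i j && arrow j i.

Lemma arrowP i j e : arrow i j -> e \in O i -> ~~ cut chi e -> cut (h j) e.
Proof. by move/forall_inP=> ij eO; apply/implyP/ij. Qed.

Lemma arrowPn i j : ~~ arrow i j ->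
  exists e, [/\ e \in O i, ~~ cut chi e & ~~ cut (h j) e].
Proof.
rewrite negb_forall_in => /exists_inP[e eO]; rewrite negb_imply => /andP[].
by exists e.
Qed.

Lemma sim_sym i j : sim i j = sim j i.
Proof. exact: andbC. Qed.

(** A negative [e] without coordinate [i] would sum to [omega] with [t j]; a positive [e] with both
    coordinates would do so with a negative edge of [O j], which has both as well. *)
Lemma sim_sign i j e : i != j -> sim i j -> e \in O i ->
  ~~ cut chi e = cut (h i) e && cut (h j) e.
Proof.
move=> nij /andP[ij ji] eO.
have : ~~ refute2 (negative_imp vy) (negative_imp vx) [:: (0, pat i j None e)].
  apply: (@refute2P i j) => // [e' e'O|e' e'O|].
  - exact/implyP/(arrowP ij).
  - exact/implyP/(arrowP ji).
  by split=> //; exists i => //; exists e.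
rewrite /pat; case: (cut (h i) e); case: (cut (h j) e); case: (cut (coord None) e);
  by case: (cut chi e) => //; vm_compute.
Qed.

(** Let [f] in [O k] be negative without coordinate [i]. Then [f] alone, [e] with [t k], or [e] with
    [f] sums to [omega]. *)
Lemma inside_arrow i k e : e \in O i -> ~~ cut (h i) e -> cut (h k) e -> arrow k i.
Proof.
move=> eO ei ek; have nik : i != k by apply: contraNneq ei => ->.
apply: contraT => /arrowPn[f [fO fchi fi]].
have : ~~ refute2 xpredT xpredT [:: (0, pat i k None e); (1, pat i k None f)].
  apply: (@refute2P i k) => //; split; first by exists i => //; exists e.
  by split=> //; exists k => //; exists f.
rewrite /pat (negPf ei) ek (negPf fi) fchi.
case: (cut (coord None) e); case: (cut (coord None) f); case: (cut (h k) f);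
  by case: (cut chi e) => //; vm_compute.
Qed.

Lemma crossing_no_arrow i k e : i != k -> arrow k i -> ~~ arrow i k ->
  e \in O i -> cut (h i) e -> ~~ cut (h k) e.
Proof.
move=> nik ki /arrowPn[f [fO fchi fk]] eO ei; apply/negP => ek.
have : ~~ refute2 xpredT (negative_imp vx) [:: (0, pat i k None e); (0, pat i k None f)].
  apply: (@refute2P i k) => // [e' e'O|]; first exact/implyP/(arrowP ki).
  split; first by exists i => //; exists e.
  by split=> //; exists i => //; exists f.
rewrite /pat ei ek (negPf fk) fchi.
case: (cut (coord None) e); case: (cut (coord None) f); case: (cut (h i) f);
  by case: (cut chi e) => //; vm_compute.
Qed.

Lemma sim_arrow_trans i j k : i != j -> j != k -> i != k ->
  sim i j -> sim j k -> arrow i k.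
Proof.
move=> nij njk nik /andP[ij ji] /andP[jk kj].
apply: contraT => /arrowPn[f [fO fchi fk]].
have : ~~ refute3 (negative_imp vy) (negative_imp (fun v => vx v && vz v))
            (negative_imp vy) [:: (0, pat i j (Some k) f)].
  apply: (@refute3P i j k) => // [e eO|e eO|e eO|].
  - exact/implyP/(arrowP ij).
  - by apply/implyP=> echi; rewrite /= /vx /vz /= !(arrowP _ eO echi).
  - exact/implyP/(arrowP kj).
  by split=> //; exists i => //; exists f.
rewrite /pat /= (negPf fk) fchi.
by case: (cut (h i) f); case: (cut (h j) f); vm_compute.
Qed.

Lemma sim_trans i j k : i != j -> j != k -> i != k -> sim i j -> sim j k -> sim i k.
Proof.
move=> nij njk nik ij jk; apply/andP; split; first exact: sim_arrow_trans ij jk.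
by apply: (@sim_arrow_trans k j i); rewrite // 1?eq_sym // sim_sym.
Qed.

Lemma sim_arrow_sim i j k : i != j -> j != k -> i != k ->
  sim i j -> arrow i k -> sim i k.
Proof.
move=> nij njk nik /andP[ij ji] ik; rewrite /sim ik /=.
apply: contraT => /arrowPn[f [fO fchi fi]].
have : ~~ refute3 (negative_imp (fun v => vy v && vz v)) (negative_imp vx) xpredT
            [:: (2, pat i j (Some k) f)].
  apply: (@refute3P i j k) => // [e eO|e eO|].
  - by apply/implyP=> echi; rewrite /= /vy /vz /= !(arrowP _ eO echi).
  - exact/implyP/(arrowP ji).
  by split=> //; exists k => //; exists f.
rewrite /pat /= (negPf fi) fchi.
by case: (cut (h j) f); case: (cut (h k) f); vm_compute.
Qed.

(** Both [O i] and [O j] have a negative edge avoiding [k], since an arrow from either to [k] would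
    put [k] into the class. The search refutes these two together with an [e] that has coordinate
    [k]. *)
Lemma sim_support i j k e : i != j -> sim i j -> i != k -> ~~ sim i k ->
  e \in O i -> ~~ cut (h k) e.
Proof.
move=> nij ij nik nsik eO; apply/negP => ek.
have njk : j != k by apply: contraNneq nsik => <-.
have [f [fO fchi fk]] : exists f, [/\ f \in O i, ~~ cut chi f & ~~ cut (h k) f].
  by apply: arrowPn; apply: contra nsik; apply: sim_arrow_sim ij.
have [g [gO gchi gk]] : exists f, [/\ f \in O j, ~~ cut chi f & ~~ cut (h k) f].
  apply: arrowPn; apply: contra nsik => jk; apply: (sim_trans nij) => //.
  by apply: (@sim_arrow_sim j i k); rewrite // 1?eq_sym // sim_sym.
case/andP: ij => ij ji.
have : ~~ refute3 (negative_imp vy) (negative_imp vx) xpredT [:: (0, pat i j (Some k) f);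
            (1, pat i j (Some k) g); (0, pat i j (Some k) e)].
  apply: (@refute3P i j k) => // [e' e'O|e' e'O|].
  - exact/implyP/(arrowP ij).
  - exact/implyP/(arrowP ji).
  split; first by exists i => //; exists f.
  split; first by exists j => //; exists g.
  by split=> //; exists i => //; exists e.
rewrite /pat /= (negPf fk) fchi (negPf gk) gchi ek.
rewrite (arrowP ij fO fchi) (arrowP ji gO gchi).
case: (cut (h i) f); case: (cut (h j) g); case: (cut (h i) e); case: (cut (h j) e);
  by case: (cut chi e); vm_compute.
Qed.

Lemma sim_inside i j k e : i != j -> j != k -> i != k -> sim i j -> sim i k ->
  e \in O i -> ~~ cut (h i) e -> cut (h j) e -> ~~ cut (h k) e.
Proof.
move=> nij njk nik ij ik eO ei ej; apply/negP => ek.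
have jk : sim j k by apply: (@sim_trans j i k); rewrite // 1?eq_sym // sim_sym.
have : ~~ refute3 (negative_imp (fun v => vy v && vz v))
            (negative_imp (fun v => vx v && vz v))
            (negative_imp (fun v => vx v && vy v)) [:: (0, pat i j (Some k) e)].
  case/andP: ij => ij ji; case/andP: ik => ik ki; case/andP: jk => jk kj.
  apply: (@refute3P i j k) => // [f fO|f fO|f fO|];
    try by apply/implyP=> fchi; rewrite /vx /vy /vz /= !(arrowP _ fO fchi).
  by split=> //; exists i => //; exists e.
rewrite /pat /= (negPf ei) ej ek.
by case: (cut chi e); vm_compute.
Qed.

(* Suppose that [i] is alone in its class, and let [K] be the set of the [k] with
   [arrow k i].  The edges of [O i] are then of two kinds: those inside a side of
   the cut [h i] have all their coordinates in [K], the crossing ones none.  By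
   laminarity all ends of crossing edges have the same [K]-coordinates.  If both
   kinds occur, let [v] be a vertex of [O i] where they meet: the only edge of
   [O i] leaving the set of vertices that agree with [v] outside [K] is the
   crossing one at [v], but a cycle meets every cut evenly.  If all edges cross,
   [h i] is a proper colouring of an odd cycle. *)
Lemma sim_partner i : exists2 j, i != j & sim i j.
Proof.
apply/exists_inP; apply: contraT; rewrite negb_exists_in => /forall_inP alone.
pose K k := (i != k) && arrow k i.
have inK e k : e \in O i -> ~~ cut (h i) e -> cut (h k) e -> K k.
  move=> eO ei ek; rewrite /K (inside_arrow eO ei ek) andbT.
  by apply: contraNneq ei => ->.
have outK e k : e \in O i -> cut (h i) e -> K k -> ~~ cut (h k) e.
  move=> eO ei /andP[nik ki]; apply: crossing_no_arrow ei => //.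
  by apply: contra (alone k nik) => ik; rewrite /sim ik.
have [p [Up szp EO]] : is_cycle (O i) by case: (Oodd i).
pose E y := [set y; next p y].
have EOi y : y \in p -> E y \in O i by move=> yp; rewrite EO; apply: imset_f.
have cutE g y : y \in p -> cut g (E y) = g y (+) g (next p y).
  by move=> yp; rewrite cut2 // eq_sym next_neq // ltnW.
have [y0 y0p ty0] : exists2 y, y \in p & t i = E y.
  by have := tO i; rewrite EO => /imsetP.
have hi0 : cut (h i) (E y0) by rewrite -ty0 th.
have crossK y z k : y \in p -> cut (h i) (E y) -> z \in E y -> K k -> h k z = h k y0.
  move=> yp hiy zE kK; have [nik _] := andP kK.
  have [[c d] quad] := cut_laminar nik.
  (* Both ends of the edge have the same [h k]-value, and one of them has [h i]-value [c]; as the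
     quadrant [(c, d)] is empty, the common value is [~~ d]. *)
  have key w : w \in p -> cut (h i) (E w) -> h k w = ~~ d /\ h k (next p w) = ~~ d.
    move=> wp hiw; move: hiw (outK _ _ (EOi _ wp) hiw kK) (quad w) (quad (next p w)).
    rewrite !cutE // !xpair_eqE; case: (h i w); case: (h i _) => // _;
      by case: (h k w); case: (h k _) => //; case: c {quad}; case: d.
  have [kw kn] := key y yp hiy; have [-> _] := key y0 y0p hi0.
  by move: zE; rewrite !inE => /orP[]/eqP->.
suff crossing e : e \in O i -> cut (h i) e.
  by have [e /crossing->] := Ocut i (h i).
rewrite EO => /imsetP[x0 x0p ->]; apply: contraT => nx0.
have [x xp /andP[nx cx]] : exists2 x, x \in p &
    ~~ cut (h i) (E x) && cut (h i) (E (next p x)).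
  apply/exists_inP; apply: contraT; rewrite negb_exists_in => /forall_inP stay.
  suff /(_ y0 y0p) : {in p, forall y, ~~ cut (h i) (E y)} by rewrite hi0.
  apply: (next_closed Up x0p nx0) => y yp ny.
  by have := stay y yp; rewrite ny.
set v := next p x in cx.
have vp : v \in p by rewrite mem_next.
pose g z := [forall k, K k || (h k z == h k v)].
have gv z y : y \in p -> cut (h i) (E y) -> z \in E y -> g z -> z = v.
  move=> yp cy zE /forallP gz; apply: vertex_eq => k.
  case: (boolP (K k)) => kK; last by have := gz k; rewrite (negPf kK) => /eqP.
  by rewrite (crossK y z) // (crossK v v) // !inE eqxx.
have := cycle_cut_sum g Up; rewrite (bigD1 v) //= big1 => [|y /andP[yp nyv]].
  have gvv : g v by apply/forallP => k; rewrite eqxx orbT.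
  rewrite gvv addbF addTb => /negbFE/forallP/(_ i).
  by rewrite /K eqxx /=; move: cx; rewrite cutE // => /[swap] /eqP->; rewrite addbb.
case: (boolP (cut (h i) (E y))) => cy.
  have -> : g y = false.
    by apply: contraNF nyv => /(gv y y yp cy)->//; rewrite !inE eqxx.
  apply: contraNF nx => gny.
  suff -> : x = y by [].
  apply: (can_inj (prev_next Up)); rewrite (gv (next p y) y) //.
  by rewrite !inE eqxx orbT.
suff -> : g y = g (next p y) by rewrite addbb.
apply: eq_forallb => k; case: (boolP (K k)) => //= kK.
suff -> : h k y = h k (next p y) by [].
apply: (cut_eqF (O2 (EOi y yp))); rewrite ?inE ?eqxx ?orbT //.
by apply: contra kK; apply: inK cy; apply: EOi.
Qed.

Definition cls i := [set k | (i == k) || sim i k].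

Lemma cls_refl i : i \in cls i.
Proof. by rewrite inE eqxx. Qed.

Lemma cls_eq i j : j \in cls i -> cls i = cls j.
Proof.
rewrite inE => /predU1P[->//|ij]; apply/setP=> k; rewrite !inE.
have [->|nij] := eqVneq i j; first by [].
have [<-|nik] := eqVneq i k; first by rewrite sim_sym ij orbT.
have [<-|njk] := eqVneq j k; first by rewrite ij.
apply/idP/idP => [ik|jk]; last exact: (sim_trans nij).
by apply: (@sim_trans j i k); rewrite // 1?eq_sym // sim_sym.
Qed.

(** On a positive edge [sim_sign] allows no second coordinate next to [i], and [sim_inside] no two
    coordinates other than [i]. *)
Lemma edge_dichotomy i e : e \in O i ->
  (cut chi e /\ exists2 l, l \in cls i & forall k, cut (h k) e = (k == l)) \/
  (~~ cut chi e /\ forall k, cut (h k) e = (k \in cls i)).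
Proof.
move=> eO; have [j nij ij] := sim_partner i.
have supp k : cut (h k) e -> k \in cls i.
  rewrite inE; case: eqVneq => //= nik; apply: contraLR => nsik.
  exact: sim_support ij nik nsik eO.
have sgn k : i != k -> sim i k -> ~~ cut chi e = cut (h i) e && cut (h k) e.
  by move=> nik ik; apply: sim_sign eO.
case: (boolP (cut chi e)) => chie; [left | right]; split=> //; last first.
  move: (sgn j nij ij); rewrite chie => /esym/andP[ei _] k.
  apply/idP/idP; first exact: supp.
  rewrite inE => /predU1P[<-//|ik]; have [<-//|nik] := eqVneq i k.
  by move: (sgn k nik ik); rewrite chie ei.
have [l el] : exists l, cut (h l) e.
  apply/existsP; apply: contraT; rewrite negb_exists => /forallP none.
  have /cards2P[a [b [nab Ee]]] : #|e| == 2 by rewrite (O2 eO).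
  case/eqP: nab; apply: vertex_eq => k.
  by apply: (cut_eqF (O2 eO) (none k)); rewrite Ee !inE eqxx ?orbT.
have one k : cut (h i) e -> cut (h k) e -> k = i.
  move=> ei ek; move: (supp k ek); rewrite inE => /predU1P[//|ik].
  apply/eqP; rewrite eq_sym; apply: contraT => nik.
  by move: (sgn k nik ik); rewrite chie ei ek.
exists l; first exact: supp.
move=> k; apply/idP/eqP => [ek|->//].
case: (boolP (cut (h i) e)) => ei; first by rewrite (one k ei ek) (one l ei el).
have nik : i != k by apply: contraNneq ei => ->.
have nil : i != l by apply: contraNneq ei => ->.
move: (supp k ek) (supp l el); rewrite !inE (negPf nik) (negPf nil) /= => ik il.
apply/eqP; apply: contraT => nkl.
by move: (sim_inside nik nkl nil ik il eO ei ek); rewrite el.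
Qed.

Lemma cls_sub i j : j \in cls i -> O i \subset O j.
Proof.
move=> ij; apply/subsetP=> e eO; have cij := cls_eq ij.
case: (edge_dichotomy eO) => [[chie [l lc el]]|[chie el]].
  (* The closing edge is improper for [chi] but crosses [h l], so the edge of [O j] found here must
     have [l] as its only coordinate. *)
  have [f fO] := Ocut j (fun x => chi x (+) h l x); rewrite cutD => chif.
  case: (edge_dichotomy fO) => [[chf [l' _ fl]]|[chf fl]].
    suff -> : e = f by [].
    apply: edge_eq (O2 eO) (O2 fO) _ => k; rewrite el fl.
    by move: chif; rewrite chf fl; case: eqP => // ->.
  by move: chif; rewrite (negPf chf) fl -cij lc.
have [f fO chif] := Ocut j chi.
case: (edge_dichotomy fO) => [[chf]|[_ fl]]; first by rewrite chf in chif.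
suff -> : e = f by [].
by apply: edge_eq (O2 eO) (O2 fO) _ => k; rewrite el fl cij.
Qed.

Lemma cls_cycle i j : j \in cls i -> O i = O j.
Proof.
move=> ij; apply/eqP; rewrite eqEsubset cls_sub //= cls_sub //.
by rewrite -(cls_eq ij) cls_refl.
Qed.

(** The cycle consists of the tree edges of the class and one negative edge closing their path. *)
Lemma card_cls_cycle i : #|O i| = #|cls i|.+1.
Proof.
have [m mO chim] := Ocut i chi.
suff -> : O i = m |: t @: cls i.
  have mt : m \notin t @: cls i.
    by apply: contra chim => /imsetP[l _ ->].
  rewrite cardsU1 mt card_imset // => l l' tl.
  by apply/eqP; rewrite -th -tl th.
have mP : forall k, cut (h k) m = (k \in cls i).
  by case: (edge_dichotomy mO) => [[chm]|[_ //]]; rewrite chm in chim.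
apply/setP=> e; rewrite !inE; apply/idP/predU1P => [eO|[->//|/imsetP[l lc ->]]].
  case: (edge_dichotomy eO) => [[_ [l lc el]]|[_ el]]; [right | left].
    apply/imsetP; exists l => //; apply: edge_eq (O2 eO) (t2 l) _ => k.
    by rewrite el th.
  by apply: edge_eq (O2 eO) (O2 mO) _ => k; rewrite el mP.
by rewrite (cls_cycle lc).
Qed.

(** * Gluing the classes *)

Definition family (D : {set 'I_n}) := [seq O i | i <- enum D].
Definition vertices (D : {set 'I_n}) := \bigcup_(i in D) cover (O i).

Lemma cover_family D : cover (union_graph (family D)) = vertices D.
Proof.
rewrite /union_graph /family big_map big_enum /=; apply/setP=> x.
apply/bigcupP/bigcupP => [[e /bigcupP[i iD ei] xe]|[i iD /bigcupP[e ei xe]]].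
  by exists i => //; apply/bigcupP; exists e.
by exists e => //; apply/bigcupP; exists i.
Qed.

Lemma tree_cover i : t i \subset cover (O i).
Proof. exact: bigcup_max (tO i) _. Qed.

Lemma vertices_cls i : vertices (cls i) = cover (O i).
Proof.
apply/setP=> x; apply/bigcupP/idP => [[j /cls_cycle<-]//|xi].
by exists i => //; apply: cls_refl.
Qed.

Lemma card_vertices_cls i : #|vertices (cls i)| = #|cls i|.+1.
Proof.
by rewrite vertices_cls card_cover_cycle ?card_cls_cycle //; case: (Oodd i).
Qed.

Lemma pruned_cactus_cls i : pruned_cactus (family (cls i)).
Proof.
apply: (@pruned_cactus_cycle _ _ (O i)); first by case: (Oodd i).
  by rewrite -vertices_cls card_vertices_cls size_map -cardE.
by move=> C /mapP[j]; rewrite mem_enum => /cls_cycle-> ->.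
Qed.

(** The invariant of the gluing; the count says that the tree edges of [D] span its vertices. *)
Definition partial_cactus (D : {set 'I_n}) : Prop :=
  [/\ forall i, i \in D -> cls i \subset D, #|vertices D| = #|D|.+1
    & pruned_cactus (family D)].

Lemma partial_cactus_grow D : partial_cactus D -> D != setT ->
  exists2 D', partial_cactus D' & #|D| < #|D'|.
Proof.
case=> clD cardD pcD nDT.
(* Otherwise membership in [vertices D] is constant along the tree, so [vertices D] is everything
   and [D] has [n] elements. *)
have [i niD /set0Pn[x xi]] : exists2 i, i \notin D &
    vertices D :&: cover (O i) != set0.
  apply/exists_inP; apply: contraT; rewrite negb_exists_in => /forall_inP away.
  have const : forall x y, (x \in vertices D) = (y \in vertices D).
    apply: tree_connected => l; apply: cut_const_on => // x y xl yl.
    have [xc yc] := (subsetP (tree_cover l) x xl, subsetP (tree_cover l) y yl).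
    case: (boolP (l \in D)) => lD.
      by apply/idP/idP => _; apply/bigcupP; exists l.
    have /negPn/eqP/setP far := away l lD.
    by move: (far x) (far y); rewrite !inE xc yc !andbT => -> ->.
  have /set0Pn[x0 x0D] : vertices D != set0 by rewrite -card_gt0 cardD.
  have vT : vertices D = setT by apply/setP=> y; rewrite (const y x0) inE.
  case/eqP: nDT; apply/eqP; rewrite eqEcard subsetT cardsT card_ord -ltnS -cardD.
  by rewrite vT cardsT cardV /=.
have disj : D :&: cls i = set0.
  apply/setP=> j; rewrite in_setI in_set0; apply/negP=> /andP[jD ij].
  case/negP: niD; apply: (subsetP (clD j jD)).
  by rewrite -(cls_eq ij) cls_refl.
pose D' := D :|: cls i.
have cardD' : #|D'| = #|D| + #|cls i| by rewrite cardsU disj cards0 subn0.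
have vD' : vertices D' = vertices D :|: vertices (cls i).
  by rewrite /vertices bigcup_setU.
have := cardsUI (vertices D) (vertices (cls i)).
rewrite -vD' cardD card_vertices_cls => cardUI.
have meet0 : 0 < #|vertices D :&: vertices (cls i)|.
  by rewrite card_gt0; apply/set0Pn; exists x; rewrite vertices_cls.
(* This bound forces the two vertex sets to share at most one vertex, and [meet0] at least one. *)
have : #|D'| < #|vertices D'|.
  apply: tree_card => [|l lD']; last first.
    by apply: subset_trans (tree_cover l) _; apply: bigcup_sup lD'.
  by rewrite vD' setU_eq0 negb_and -card_gt0 cardD.
rewrite cardD' => ltD'.
have [cardvD' meet1] : #|vertices D'| = #|D'|.+1 /\
    #|vertices D :&: vertices (cls i)| = 1.
  by rewrite cardD'; lia.
exists D'; last first.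
  rewrite cardD' -[X in X < _]addn0 ltn_add2l card_gt0.
  by apply/set0Pn; exists i; apply: cls_refl.
split=> //.
  move=> j; rewrite in_setU => /orP[/clD jD|ij].
    exact: subset_trans jD (subsetUl _ _).
  by rewrite -(cls_eq ij) subsetUr.
apply: (@pruned_cactus_join _ _ (family D) (family (cls i))) => //.
- rewrite -map_cat; apply: perm_map; apply: uniq_perm; rewrite ?enum_uniq //.
    rewrite cat_uniq !enum_uniq andbT /=; apply/hasPn=> j; rewrite !mem_enum => ji.
    by apply/negP=> jD; have /setP/(_ j) := disj; rewrite inE jD ji inE.
  by move=> j; rewrite mem_cat !mem_enum in_setU.
- exact: pruned_cactus_cls.
by rewrite !cover_family.
Qed.

Lemma tree_pruned_cactus : 0 < n -> pruned_cactus (family setT).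
Proof.
move=> n0.
suff grow k (D : {set 'I_n}) : n - #|D| <= k -> partial_cactus D ->
    pruned_cactus (family setT).
  pose i := Ordinal n0; apply: (grow n (cls i)); first exact: leq_subr.
  split; [|exact: card_vertices_cls|exact: pruned_cactus_cls].
  by move=> j /cls_eq->.
elim: k D => [|k IH] D leD pcD; have [DT|nDT] := eqVneq D setT;
  try by case: pcD; rewrite DT.
  case/eqP: nDT; apply/eqP; rewrite eqEcard subsetT cardsT card_ord.
  by rewrite -subn_eq0 -leqn0.
have [D' pcD' ltD] := partial_cactus_grow pcD nDT.
apply: IH pcD'; rewrite -ltnS (leq_trans _ leD) //.
apply: ltn_sub2l ltD; rewrite -[X in _ < X]card_ord -cardsT.
by apply: proper_card; rewrite properT.
Qed.

End Tree.

Lemma rainbow_free_pruned_cactus : 0 < n -> pruned_cactus [seq O i | i <- enum 'I_n].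
Proof.
move=> n0; have [t [chi [h [tO tchi th]]]] := rainbow_tree.
by have := tree_pruned_cactus tO tchi th n0; rewrite /family enum_setT -enumT.
Qed.

End Family.

(** * From a sequence of cycles to an indexed family *)

Lemma rainbow_choice_bipartite (V : finType) (O : seq {set {set V}})
    (s : 'I_(size O) -> {set V}) :
  (forall C, C \in O -> is_odd_cycle C) -> ~ has_rainbow_odd_cycle O ->
  (forall i : 'I_(size O), s i \in nth set0 O i) ->
  exists g : V -> bool, forall i, cut g (s i).
Proof.
move=> Oodd noR sO.
have [_ /imsetP[i _ ->]|C sC oddC|g gP] := @no_odd_cycle_bipartite V (s @: setT).
- have [cyc _] := Oodd _ (mem_nth set0 (ltn_ord i)).
  exact: cycle_edge_card cyc (sO i).
- case: noR; exists C; split=> //.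
  have sP e : e \in C -> exists i, s i = e.
    by move=> /(subsetP sC)/imsetP[i _ ->]; exists i.
  split.
    apply/subsetP=> e /sP[i <-]; rewrite /union_graph (big_nth set0) big_mkord.
    by apply/bigcupP; exists i.
  (* Several positions may choose the same edge, so one of them is picked. Injectivity holds because
     [s] recovers the edge; the default 0 is never reached on [C]. *)
  pose sigma e := if [pick i | s i == e] is Some i then nat_of_ord i else 0.
  have sigmaP e : e \in C -> exists2 i, sigma e = nat_of_ord i & s i = e.
    rewrite /sigma; case: pickP => [i /eqP <- _|none /sP[i si]]; first by exists i.
    by have := none i; rewrite si eqxx.
  exists sigma; split=> [e e' /sigmaP[i -> <-] /sigmaP[i' -> <-] /ord_inj->//|e].
  by case/sigmaP=> i -> <-.
by exists g => i; apply: gP; apply: imset_f.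
Qed.

Theorem theorem2p3 (n : nat) (hn : 0 < n) (O : seq {set {set 'I_n.+1}})
    (hsize : size O = n)
    (hodd : forall C, C \in O -> is_odd_cycle C)
    (hrainbow : ~ has_rainbow_odd_cycle O) :
  pruned_cactus O.
Proof.
have <- : [seq nth set0 O (val i) | i <- enum 'I_(size O)] = O.
  by rewrite -[RHS](mkseq_nth set0) /mkseq -val_enum_ord -map_comp.
apply: rainbow_free_pruned_cactus => [|i|s sO|].
- by rewrite card_ord hsize.
- by apply: hodd; apply: mem_nth; apply: ltn_ord.
- exact: rainbow_choice_bipartite sO.
by rewrite hsize.
Qed.
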